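(* Let $1\le r<\infty$ and let $\mathcal A$ be a (real- or complex-valued) function on $\mathbb J_0=[1,2]\times[2^{-3},2^{-2}]$ with $[\mathcal A]_{r,2}<\infty$. Then for any $(t_0,s_0)\in\mathbb J_0$ the quadrant limits $$\lim_{t\to t_0^+,\,s\to s_0^+}\mathcal A(t,s),\quad\lim_{t\to t_0^+,\,s\to s_0^-}\mathcal A(t,s),\quad\lim_{t\to t_0^-,\,s\to s_0^+}\mathcal A(t,s),\quad\lim_{t\to t_0^-,\,s\to s_0^-}\mathcal A(t,s)$$ exist whenever the corresponding quadrant is nonempty. Furthermore, there exist countable sets $X\subset[1,2]$ and $Y\subset[2^{-3},2^{-2}]$ such that $\mathcal A$ is continuous at $(t_0,s_0)$ whenever $t_0\notin X$ and $s_0\notin Y$ (with $(t_0,s_0)\in\mathbb J_0$).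
   Context: The quadrant limit $t\to t_0^{\pm},s\to s_0^{\pm}$ is the joint limit as $(t,s)\to(t_0,s_0)$ within the open quadrant of points $(t,s)\in\mathbb J_0$ with $t>t_0$ (resp. $t<t_0$) and $s>s_0$ (resp. $s<s_0$), according to the signs. One-parameter variation: for a function $a$ on an interval $I$, $[a]_{r,1}=\sup_{L\in\mathbb N}\sup_{t_1<\cdots<t_L,\ t_j\in I}\big(\sum_{j=1}^{L-1}|a(t_{j+1})-a(t_j)|^r\big)^{1/r}$. Rectangular variation: for a rectangle $Q=[t_1,t_2]\times[s_1,s_2]\subset\mathbb J_0$, $\mathcal A(Q)=\mathcal A(t_2,s_2)-\mathcal A(t_1,s_2)+\mathcal A(t_1,s_1)-\mathcal A(t_2,s_1)$, and $\{\mathcal A\}_{r,2}=\sup\big(\sum_{j,k}|\mathcal A(I_j\times J_k)|^r\big)^{1/r}$, the supremum being over all finite partitions of $[1,2]$ into intervals $\{I_j\}$ and of $[2^{-3},2^{-2}]$ into intervals $\{J_k\}$ (closed intervals with disjoint interiors). Two-parameter variation norm: $[\mathcal A]_{r,2}=\{\mathcal A\}_{r,2}+[\mathcal A(1,\cdot)]_{r,1}+[\mathcal A(\cdot,2^{-3})]_{r,1}+|\mathcal A(1,2^{-3})|$, where $\mathcal A(1,\cdot)$ is a function on $[2^{-3},2^{-2}]$ and $\mathcal A(\cdot,2^{-3})$ a function on $[1,2]$. *)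

(* Defs.v *)
From HB Require Import structures.
From mathcomp Require Import all_boot all_order all_algebra.
From mathcomp Require Import complex.
From mathcomp Require Import all_classical all_reals all_analysis.
Set Implicit Arguments.
Unset Strict Implicit.
Unset Printing Implicit Defensive.
Import Order.TTheory GRing.Theory Num.Theory.
Import numFieldNormedType.Exports.
Local Open Scope classical_set_scope.
Local Open Scope ring_scope.

Definition T0 {R : realType} : set R := `[1, 2]%classic.
Definition S0 {R : realType} : set R := `[2 ^- 3, 2 ^- 2]%classic.
Definition J0 {R : realType} : set (R * R) := T0 `*` S0.

(* Functions on an interval or on J0 are represented by total functions; the
   values off the domain never enter the definitions below. *)

Section Variation.
Context {R : realType} {V : normedZmodType R}.
Implicit Types (r : R) (A : R * R -> V).

(* The sequence t lists the points t_1 < ... < t_L. *)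
Definition variation1 r (I : set R) (a : R -> V) : \bar R :=
  ereal_sup
    [set ((\sum_(j < (size t).-1) `|a t`_j.+1 - a t`_j| `^ r) `^ r^-1)%:E
    | t in [set t : seq R | sorted <%R t /\ (forall x, x \in t -> I x)]].

Definition rect_incr A (t1 t2 s1 s2 : R) : V :=
  A (t2, s2) - A (t1, s2) + A (t1, s1) - A (t2, s1).

(* itv_partition a b u says that a :: u is strictly increasing and ends at b;
   the intervals of the partition are [(a :: u)_j, (a :: u)_(j + 1)]. *)
Definition rect_variation r A : \bar R :=
  ereal_sup
    [set ((\sum_(j < size p.1) \sum_(k < size p.2)
             `|rect_incr A (1 :: p.1)`_j (1 :: p.1)`_j.+1
                           (2 ^- 3 :: p.2)`_k (2 ^- 3 :: p.2)`_k.+1| `^ r)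
            `^ r^-1)%:E
    | p in [set p : seq R * seq R |
             itv_partition 1 2 p.1 /\ itv_partition (2 ^- 3) (2 ^- 2) p.2]].

Definition variation2 r A : \bar R :=
  (rect_variation r A
   + variation1 r S0 (fun s => A (1%R, s))
   + variation1 r T0 (fun t => A (t, (2 ^- 3)%R))
   + `|A (1%R, (2 ^- 3)%R)|%:E)%E.

End Variation.

Arguments variation2 {R} V r A : assert.

(* One-sided half-line at x: to the right if e is true, to the left otherwise. *)
Definition side {R : realType} (e : bool) (x : R) : set R :=
  if e then `]x, +oo[%classic else `]-oo, x[%classic.

Definition quadrant {R : realType} (e e' : bool) (t0 s0 : R) : set (R * R) :=
  J0 `&` (side e t0 `*` side e' s0).

Definition has_quadrant_limits {R : realType} {T : topologicalType}
    (A : R * R -> T) : Prop :=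
  forall t0 s0, J0 (t0, s0) -> forall e e' : bool,
    quadrant e e' t0 s0 !=set0 ->
    exists l : T, A z @[z --> within (quadrant e e' t0 s0) (nbhs (t0, s0))] --> l.

Definition continuous_off_countable {R : realType} {T : topologicalType}
    (A : R * R -> T) : Prop :=
  exists X Y : set R,
    [/\ X `<=` T0, Y `<=` S0, countable X, countable Y &
      forall t0 s0, J0 (t0, s0) -> ~ X t0 -> ~ Y s0 ->
        A z @[z --> within J0 (nbhs (t0, s0))] --> A (t0, s0)].

(* Main.v *)
Require Import Defs.
From HB Require Import structures.
From mathcomp Require Import all_boot all_order all_algebra.
From mathcomp Require Import complex.
From mathcomp Require Import all_classical all_reals all_analysis.
From mathcomp Require Import lra.
Set Implicit Arguments.
Unset Strict Implicit.
Unset Printing Implicit Defensive.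
Import Order.TTheory GRing.Theory Num.Theory.
Import numFieldNormedType.Exports.
Local Open Scope classical_set_scope.
Local Open Scope ring_scope.

(* Regard A as a map t |-> A (t, .) into bounded functions of s with the sup
   norm.  This map is regulated, i.e. Cauchy on each side of every point t0.
   Indeed A (t, s) - A (t', s) is, up to the boundary term
   A (t, 1/8) - A (t', 1/8), the increment of A on [t', t] x [1/8, s].  If those
   increments were not uniformly small as t, t' -> t0 from one side, compactness
   would give a value s0 and a side of s0 from which points s witness this; since
   for each fixed s the increments do tend to 0, one builds points (t_k, s_k)
   with t_k -> t0 and s_k -> s0 monotone and the increments on
   [t_k, t_(k+1)] x [s_k, s_(k+1)] bounded below, so that the diagonal cells of
   a fine grid contradict the finiteness of the r-variation.  The same holds with
   the roles of t and s exchanged, which gives the quadrant limits; and a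
   regulated map has, for each eps, only isolated points of oscillation >= eps,
   hence countably many discontinuities. *)

(** * Monotone sequences and partitions of an interval *)

Section Sequences.
Context {R : realType}.
Implicit Types (a b : R) (x : nat -> R).

(** Weak monotonicity in either direction, so that a chain approaching a point from the left or from
    the right is covered as it stands. *)
Definition monotone_in a b x :=
  (forall n, a <= x n <= b) /\
  ({homo x : m n / (m <= n)%N >-> m <= n} \/
   {homo x : m n / (m <= n)%N >-> n <= m}).

(** Induction on [n] builds [p]: a repeated point is dropped, since [Phi] vanishes on the diagonal,
    and the final cell up to [b] only adds a nonnegative term. *)
Lemma nondecreasing_sum_partition x n b :
    {homo x : m n / (m <= n)%N >-> m <= n} -> x n <= b ->
  exists2 p, itv_partition (x 0%N) b p &
    forall Phi : R -> R -> R,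
      (forall u v, 0 <= Phi u v) -> (forall u, Phi u u = 0) ->
      \sum_(j < n) Phi (x j) (x j.+1) <=
        \sum_(j < size p) Phi (x 0%N :: p)`_j (x 0%N :: p)`_j.+1.
Proof.
elim: n x => [|n IHn] x x_nd xb.
  have [xb'|xb'] := eqVneq (x 0%N) b.
    exists [::]; first by rewrite xb'; split => /=.
    by move=> Phi _ _; rewrite !big_ord0.
  exists [:: b]; first by apply: itv_partition1; rewrite lt_neqAle xb'.
  by move=> Phi Phi_ge0 _; rewrite big_ord0 sumr_ge0.
have [p px sum_p] := IHn (x \o S) (fun i j ij => x_nd i.+1 j.+1 ij) xb.
have [x01|x01] := eqVneq (x 0%N) (x 1%N).
  exists p => [|Phi Phi_ge0 Phi_diag]; first by rewrite x01.
  by rewrite big_ord_recl/= x01 Phi_diag add0r; exact: sum_p.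
exists (x 1%N :: p) => [|Phi Phi_ge0 Phi_diag].
  by case: px => p1 p2; split => //=; rewrite p1 lt_neqAle x01 x_nd.
by rewrite !big_ord_recl/= lerD2l; exact: sum_p.
Qed.

Lemma monotone_sum_partition a b x n : monotone_in a b x ->
  exists2 p, itv_partition a b p &
    forall Phi : R -> R -> R,
      (forall u v, 0 <= Phi u v) -> (forall u, Phi u u = 0) ->
      (forall u v, Phi u v = Phi v u) ->
      \sum_(j < n) Phi (x j) (x j.+1) <=
        \sum_(j < size p) Phi (a :: p)`_j (a :: p)`_j.+1.
Proof.
move=> [xab x_mono].
wlog x_nd : x xab {x_mono} / {homo x : m n / (m <= n)%N >-> m <= n}.
  move=> nd_case; case: x_mono => [|x_ni]; first exact: nd_case.
  (* Reversal of the first [n + 1] terms; truncated subtraction makes the sequence constant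
     afterwards, hence still monotone. *)
  have [|i j ij|p pab sum_p] := nd_case (fun k => x (n - k)%N).
  - by [].
  - by rewrite x_ni// leq_sub2l.
  exists p => // Phi Phi_ge0 Phi_diag PhiC.
  apply: le_trans (sum_p _ Phi_ge0 Phi_diag PhiC).
  rewrite (reindex_inj rev_ord_inj)/= ler_sum// => i _.
  by rewrite PhiC -subSn// subSS.
(* Prepending [a] makes the partition start there; the extra first term is nonnegative. *)
have [i j ij||p pab sum_p] := @nondecreasing_sum_partition
    (fun k => if k is k.+1 then x k else a) n.+1 b.
- by case: i j ij => [|i] [|j] //= ij; [case/andP: (xab j)|exact: x_nd].
- by case/andP: (xab n).
exists p => // Phi Phi_ge0 Phi_diag _.
apply: le_trans (sum_p _ Phi_ge0 Phi_diag).
by rewrite big_ord_recl/= lerDr.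
Qed.

End Sequences.

Lemma itv_partition_sub (R : realType) (a b : R) p :
  itv_partition a b p -> forall u, u \in a :: p -> a <= u <= b.
Proof.
move=> pab u /(nthP b)[i ip <-].
by rewrite (itv_partition_nth_ge ip pab) (itv_partition_nth_le ip pab).
Qed.

(** * Finite variation as a bound on sums along monotone sequences *)

Section BoundedVariation.
Context {R : realType} {V : normedZmodType R} (r : R).

Definition bounded_variation1 (a b : R) (f : R -> V) :=
  exists C : R, forall x, monotone_in a b x -> forall n,
    \sum_(j < n) `|f (x j) - f (x j.+1)| `^ r <= C.

Definition bounded_variation2 (a b c d : R) (A : R * R -> V) :=
  exists C : R, forall x y, monotone_in a b x -> monotone_in c d y ->
    forall n m, \sum_(j < n) \sum_(k < m)
      `|rect_incr A (x j) (x j.+1) (y k) (y k.+1)| `^ r <= C.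


Lemma le_powRV_bound (T : Type) (F : T -> R) (D : set T) :
    0 < r -> (forall i, D i -> 0 <= F i) ->
    (ereal_sup [set (F i `^ r^-1)%:E | i in D] < +oo)%E ->
  exists C, forall i, D i -> F i <= C.
Proof.
move=> r0 F0; set M := ereal_sup _.
have ubM i : D i -> ((F i `^ r^-1)%:E <= M)%E.
  by move=> Di; apply: ereal_sup_ubound; exists i.
(* A supremum equal to [-oo] leaves no index in [D], so any constant is a bound. *)
case: M ubM => [M||] ubM // _; last by exists 0 => i /ubM.
exists (M `^ r) => i Di.
have := ubM i Di; rewrite lee_fin => FM.
have -> : F i = (F i `^ r^-1) `^ r.
  by rewrite -powRrM mulVf ?lt0r_neq0// powRr1// F0.
rewrite ge0_ler_powR ?nnegrE ?powR_ge0 ?(le_trans (powR_ge0 _ _) FM)//.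
exact: ltW.
Qed.

Lemma variation1_ge0 I (f : R -> V) : (0 <= variation1 r I f)%E.
Proof.
apply: le_trans (ereal_sup_ubound _); last first.
  by exists [::].
by rewrite lee_fin powR_ge0.
Qed.

Lemma rect_variation_ge0 (A : R * R -> V) : (0 <= rect_variation r A)%E.
Proof.
apply: le_trans (ereal_sup_ubound _); last first.
  exists ([:: 2], [:: 2 ^- 2]) => //=.
  by split; apply: itv_partition1; lra.
by rewrite lee_fin powR_ge0.
Qed.

(** Nonnegativity of the summands excludes [-oo], which would absorb a [+oo] in an extended real
    sum. *)
Lemma variation2_fin (A : R * R -> V) : (variation2 V r A < +oo)%E ->
  [/\ (rect_variation r A < +oo)%E,
      (variation1 r S0 (fun s => A (1%R, s)) < +oo)%E &
      (variation1 r T0 (fun t => A (t, (2 ^- 3)%R)) < +oo)%E].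
Proof.
rewrite /variation2.
have := rect_variation_ge0 A.
have := variation1_ge0 S0 (fun s => A (1%R, s)).
have := variation1_ge0 T0 (fun t => A (t, (2 ^- 3)%R)).
case: (rect_variation r A) => [?| |] //;
case: (variation1 r S0 _) => [?| |] //;
case: (variation1 r T0 _) => [?| |] // _ _ _ _.
by rewrite !ltry.
Qed.

Lemma variation1_bounded a b (f : R -> V) : 0 < r ->
  (variation1 r `[a, b]%classic f < +oo)%E -> bounded_variation1 a b f.
Proof.
move=> r0 var_fin; have [|C ub] := le_powRV_bound r0 _ var_fin.
  by move=> ? _; apply: sumr_ge0 => *; exact: powR_ge0.
exists C => x x_mono n; have [p pab sum_p] := monotone_sum_partition n x_mono.
have {}sum_p := sum_p (fun u v => `|f u - f v| `^ r).
apply: le_trans (sum_p _ _ _) _ => [||u v|].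
- by move=> *; exact: powR_ge0.
- by move=> u; rewrite subrr normr0 powR0// lt0r_neq0.
- by rewrite distrC.
under eq_bigr do rewrite distrC.
apply: (ub (a :: p)); split=> [|u /(itv_partition_sub pab)]; first by case: pab.
by rewrite /= in_itv.
Qed.

Lemma rect_incrCl (A : R * R -> V) t1 t2 s1 s2 :
  rect_incr A t1 t2 s1 s2 = - rect_incr A t2 t1 s1 s2.
Proof. by rewrite /rect_incr !opprD !opprK [in RHS](ACl (2*1*4*3)%AC). Qed.

Lemma rect_incrCr (A : R * R -> V) t1 t2 s1 s2 :
  rect_incr A t1 t2 s1 s2 = - rect_incr A t1 t2 s2 s1.
Proof. by rewrite /rect_incr !opprD !opprK [in RHS](ACl (4*3*2*1)%AC). Qed.

Lemma rect_incrDl (A : R * R -> V) t1 t2 t3 s1 s2 :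
  rect_incr A t1 t3 s1 s2 = rect_incr A t1 t2 s1 s2 + rect_incr A t2 t3 s1 s2.
Proof.
rewrite /rect_incr !addrA [RHS](ACl (5*2*3*8*((1*6)*(7*4)))%AC)/=.
by rewrite !subrr !addr0.
Qed.

Lemma rect_incrDr (A : R * R -> V) t1 t2 s1 s2 s3 :
  rect_incr A t1 t2 s1 s3 = rect_incr A t1 t2 s1 s2 + rect_incr A t1 t2 s2 s3.
Proof.
rewrite /rect_incr !addrA [RHS](ACl (5*6*3*4*((1*8)*(2*7)))%AC)/=.
by rewrite subrr addNr !addr0.
Qed.

(** The comparison with partitions is made in one variable at a time: in [t] with the inner sum over
    [y] as [Phi], then in [s] inside each cell of [p]. *)
Lemma rect_variation_bounded (A : R * R -> V) : 0 < r ->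
  (rect_variation r A < +oo)%E ->
  bounded_variation2 1 2 (2 ^- 3) (2 ^- 2) A.
Proof.
move=> r0 var_fin; have [|C ub] := le_powRV_bound r0 _ var_fin.
  by move=> ? _; do 2!apply: sumr_ge0 => ? _; exact: powR_ge0.
exists C => x y x_mono y_mono n m.
have [p px sum_p] := monotone_sum_partition n x_mono.
have [q qy sum_q] := monotone_sum_partition m y_mono.
apply: le_trans (ub (p, q) (conj px qy)) => /=.
pose Phi u v := \sum_(k < m) `|rect_incr A u v (y k) (y k.+1)| `^ r.
apply: le_trans (sum_p Phi _ _ _) _ => [u v|u|u v|].
- by apply: sumr_ge0 => *; exact: powR_ge0.
- rewrite /Phi big1// => k _.
  by rewrite /rect_incr subrr add0r subrr normr0 powR0// lt0r_neq0.
- by apply: eq_bigr => k _; rewrite rect_incrCl normrN.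
apply: ler_sum => j _.
apply: le_trans (sum_q (fun u v => `|rect_incr A _ _ u v| `^ r) _ _ _) _
  => [u v|u|u v|//].
- exact: powR_ge0.
- by rewrite /rect_incr subrK subrr normr0 powR0// lt0r_neq0.
- by rewrite rect_incrCr normrN.
Qed.

(** * One-sided Cauchy criteria *)

Definition side_nbhs (a b : R) (e : bool) (x0 : R) : set_system R :=
  within (`[a, b]%classic `&` side e x0) (nbhs x0).

#[local] Instance side_nbhs_filter a b e x0 : Filter (side_nbhs a b e x0).
Proof. exact: within_filter. Qed.

Lemma near_side_nbhs a b e x0 :
  \forall x \near side_nbhs a b e x0, `[a, b]%classic x /\ side e x0 x.
Proof. exact: near_withinT. Qed.

Lemma side_neq e (x0 x : R) : side e x0 x -> x != x0.
Proof.
by case: e; rewrite /side/= in_itv/= ?andbT => xx0; rewrite neq_lt xx0 ?orbT.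
Qed.

Lemma near_closer a b e x0 (x : R) : side e x0 x ->
  \forall u \near side_nbhs a b e x0, `|u - x0| < `|x - x0|.
Proof.
move=> /side_neq xx0; apply: cvg_within; apply/nbhs_ballP.
exists `|x - x0|; first by rewrite /= normr_gt0 subr_eq0.
by move=> u; rewrite /ball/= distrC.
Qed.

(** On one side of [x0], getting closer to [x0] means moving in a fixed direction: down from the
    right, up from the left. *)
Lemma closer_monotone a b e x0 (x : nat -> R) :
    (forall n, `[a, b]%classic (x n) /\ side e x0 (x n)) ->
    (forall n, `|x n.+1 - x0| < `|x n - x0|) ->
  monotone_in a b x.
Proof.
move=> xab xlt; split=> [n|].
  by have [] := xab n; rewrite /= in_itv.
case: e xab => xab; [right|left].
  apply: (@homo_leq _ x (fun u v => v <= u)) => [u|u v w vu wu|n] //.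
    exact: le_trans wu vu.
  have [[_ +] [_ +]] := (xab n, xab n.+1); move: (xlt n).
  rewrite /side/= !in_itv/= !andbT => + h1 h2.
  by rewrite !gtr0_norm ?subr_gt0// ltrD2r => /ltW.
apply: homo_leq => [u|v u w|n] //; first exact: le_trans.
have [[_ +] [_ +]] := (xab n, xab n.+1); move: (xlt n).
rewrite /side/= !in_itv/= => + h1 h2.
by rewrite !ltr0_norm ?subr_lt0// ltrN2 ltrD2r => /ltW.
Qed.

Lemma bounded_muln_le0 (C u : R) : (forall n, u *+ n <= C) -> u <= 0.
Proof.
move=> uC; rewrite leNgt; apply/negP => u0.
have := uC (Num.truncn (C / u)).+1.
rewrite -mulr_natr -ler_pdivlMl// mulrC leNgt.
by rewrite truncnS_gt.
Qed.

(** Otherwise every point of the side admits a strictly closer one at which [f] differs by at least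
    [eps / 2]. Iterating gives a monotone sequence whose first [n] jumps contribute at least [n]
    times [(eps / 2) ^ r], which is unbounded. *)
Lemma bounded_variation1_cauchy a b (f : R -> V) e x0 eps : 0 < r -> 0 < eps ->
    bounded_variation1 a b f ->
  \forall p & q \near side_nbhs a b e x0, `|f p - f q| < eps.
Proof.
move=> r0 eps0 [C fC].
pose D x := `[a, b]%classic x /\ side e x0 x.
apply: contrapT => not_cauchy.
have step x : {x' : R | D x -> [/\ D x', `|x' - x0| < `|x - x0| &
                              eps / 2 <= `|f x - f x'|]}.
  apply: cid; apply: contrapT => /forallNP no_step; apply: not_cauchy.
  (* Off [D] the implication in [step] is vacuous, so any witness, here [0], refutes [no_step]. *)
  have Dx : D x by apply: contrapT => nDx; apply: (no_step 0) => /nDx.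
  have close x' : D x' -> `|x' - x0| < `|x - x0| -> `|f x - f x'| < eps / 2.
    move=> Dx' x'x; rewrite ltNge; apply/negP => far.
    by apply: (no_step x').
  near=> p q.
  have /close-/(_ _) fxp : D p by near: p; exact: near_side_nbhs.
  have /close-/(_ _) fxq : D q by near: q; exact: near_side_nbhs.
  rewrite (splitr eps) -(subrKA (f x)); apply: le_lt_trans (ler_normD _ _) _.
  rewrite ltrD//; [rewrite distrC; apply: fxp|apply: fxq].
    by near: p; apply: near_closer; case: Dx.
  by near: q; apply: near_closer; case: Dx.
(* With no point of [[a, b]] on that side the filter is improper and the Cauchy property holds
   vacuously. *)
have [x1 Dx1] : exists x1, D x1.
  apply: contrapT => /forallNP noD; apply: not_cauchy; near=> p q.
  by case: (noD p); near: p; exact: near_side_nbhs.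
have [x [x0E xS]] := dependent_choice step x1.
have Dx n : D (x n) by elim: n => [|n /xS[]//]; rewrite x0E.
have x_mono : monotone_in a b x.
  by apply: (@closer_monotone a b e x0) => // n; case: (xS n (Dx n)).
have : (eps / 2) `^ r <= 0.
  apply: (@bounded_muln_le0 C) => n; apply: le_trans (fC x x_mono n).
  rewrite -[X in _ *+ X]card_ord -sumr_const ler_sum// => j _.
  have [_ _ h] := xS j (Dx j).
  by apply: ge0_ler_powR h; rewrite ?nnegrE// ltW// divr_gt0.
by apply/negP; rewrite -ltNge powR_gt0// divr_gt0.
Unshelve. all: by end_near. Qed.

(* Otherwise one could move from any point of the quadrant to a strictly closer
   one, in both coordinates, with rectangular increment at least [eps / 4]; the
   rectangles of such a chain are the diagonal cells of a grid. *)
Lemma bounded_variation2_cauchy_quadrant a b c d (A : R * R -> V) e e' x0 y0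
    eps : 0 < r -> 0 < eps ->
    bounded_variation2 a b c d A ->
    (forall s, c <= s <= d -> forall eta, 0 < eta ->
       \forall p & q \near side_nbhs a b e x0, `|rect_incr A p q c s| < eta) ->
  \forall s \near side_nbhs c d e' y0 & pq \near
    (side_nbhs a b e x0, side_nbhs a b e x0), `|rect_incr A pq.1 pq.2 c s| < eps.
Proof.
move=> r0 eps0 [C AC] row_cauchy.
pose D z := (`[a, b]%classic z.1 /\ side e x0 z.1) /\
            (`[c, d]%classic z.2 /\ side e' y0 z.2).
apply: contrapT => not_cauchy.
have step z : {z' : R * R | D z -> [/\ D z', `|z'.1 - x0| < `|z.1 - x0|,
    `|z'.2 - y0| < `|z.2 - y0| & eps / 4 <= `|rect_incr A z.1 z'.1 z.2 z'.2|]}.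
  apply: cid; apply: contrapT => /forallNP no_step; apply: not_cauchy.
  have Dz : D z by apply: contrapT => nDz; apply: (no_step (0, 0)) => /nDz.
  have close z' : D z' -> `|z'.1 - x0| < `|z.1 - x0| ->
      `|z'.2 - y0| < `|z.2 - y0| -> `|rect_incr A z.1 z'.1 z.2 z'.2| < eps / 4.
    move=> Dz' x'x y'y; rewrite ltNge; apply/negP => far.
    by apply: (no_step z').
  case: Dz => [[abz xz] [cdz yz]].
  have near1 : \forall p & q \near side_nbhs a b e x0,
      `|rect_incr A p q c z.2| < eps / 2.
    by apply: row_cauchy; rewrite ?divr_gt0//; move: cdz; rewrite /= in_itv.
  have near2 : \forall p & q \near side_nbhs a b e x0,
      [/\ `[a, b]%classic p /\ side e x0 p, `|p - x0| < `|z.1 - x0|,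
          `[a, b]%classic q /\ side e x0 q & `|q - x0| < `|z.1 - x0|].
    near=> p q; split => /=.
    - by near: p; exact: near_side_nbhs.
    - by near: p; exact: near_closer.
    - by near: q; exact: near_side_nbhs.
    - by near: q; exact: near_closer.
  near=> s pq => /=.
  have [//|abp pz abq qz] := near near2 pq.
  (* Cutting [[c, s]] at [z.2] leaves a row increment, below [eps / 2], and a difference of two
     rectangles with corner [z], each below [eps / 4]. *)
  have -> : rect_incr A pq.1 pq.2 c s = rect_incr A pq.1 pq.2 c z.2 +
      (rect_incr A z.1 pq.2 z.2 s - rect_incr A z.1 pq.1 z.2 s).
    rewrite -rect_incrCl addrC (addrC (rect_incr _ z.1 _ _ _)) -rect_incrDl.
    by rewrite addrC -rect_incrDr.
  rewrite (splitr eps); apply: le_lt_trans (ler_normD _ _) _.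
  rewrite ltrD//; first by near: pq.
  have -> : eps / 2 = eps / 4 + eps / 4 by lra.
  apply: le_lt_trans (ler_normB _ _) _.
  have [cds ys] : `[c, d]%classic s /\ side e' y0 s.
    by near: s; exact: near_side_nbhs.
  have sz : `|s - y0| < `|z.2 - y0| by near: s; exact: near_closer.
  have closer u : `[a, b]%classic u /\ side e x0 u -> `|u - x0| < `|z.1 - x0| ->
      `|rect_incr A z.1 u z.2 s| < eps / 4.
    by move=> abu uz; exact: (close (u, s)).
  by rewrite ltrD//; apply: closer.
have [z1 Dz1] : exists z1, D z1.
  apply: contrapT => /forallNP noD; apply: not_cauchy.
  have nearD : \forall p & q \near side_nbhs a b e x0,
      `[a, b]%classic p /\ side e x0 p.
    by near=> p q => /=; near: p; exact: near_side_nbhs.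
  near=> s pq; case: (noD (pq.1, s)); split => /=; first exact: (near nearD pq).
  by near: s; exact: near_side_nbhs.
have [z [z0E zS]] := dependent_choice step z1.
have Dz n : D (z n) by elim: n => [|n /zS[]//]; rewrite z0E.
have x_mono : monotone_in a b (fun n => (z n).1).
  apply: (@closer_monotone a b e x0) => n; first by case: (Dz n).
  by case: (zS n (Dz n)).
have y_mono : monotone_in c d (fun n => (z n).2).
  apply: (@closer_monotone c d e' y0) => n; first by case: (Dz n).
  by case: (zS n (Dz n)).
have : (eps / 4) `^ r <= 0.
  apply: (@bounded_muln_le0 C) => n; apply: le_trans (AC _ _ x_mono y_mono n n).
  rewrite -[X in _ *+ X]card_ord -sumr_const ler_sum// => j _.
  rewrite (bigD1 j)//= -[leLHS]addr0 lerD//; last first.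
    by apply: sumr_ge0 => *; exact: powR_ge0.
  have [_ _ _ h] := zS j (Dz j).
  by apply: ge0_ler_powR h; rewrite ?nnegrE// ltW// divr_gt0.
by apply/negP; rewrite -ltNge powR_gt0// divr_gt0.
Unshelve. all: by end_near. Qed.

Lemma rect_incr_subE (A : R * R -> V) t1 t2 s1 s2 :
  rect_incr A t1 t2 s1 s2 =
    - ((A (t1, s2) - A (t1, s1)) - (A (t2, s2) - A (t2, s1))).
Proof. by rewrite /rect_incr !opprD !opprK addrA [RHS](ACl (3*1*2*4)%AC). Qed.

Lemma bounded_variation2_row a b c d (A : R * R -> V) s :
    c <= s <= d -> bounded_variation2 a b c d A ->
  bounded_variation1 a b (fun t => A (t, s) - A (t, c)).
Proof.
move=> csd [C AC]; exists C => x x_mono n.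
(* The sequence [c, s, s, ...], read for one step, turns the grid into the single strip [[c, s]]. *)
have y_mono : monotone_in c d (fun k => if k is 0%N then c else s).
  case/andP: (csd) => cs sd; split.
    by case=> //; rewrite lexx (le_trans cs).
  by left; case=> [|i] [|j].
apply: le_trans (AC _ _ x_mono y_mono n 1%N).
by apply: ler_sum => j _; rewrite big_ord1/= rect_incr_subE normrN.
Qed.

(* For a fixed s the increments of t |-> A (t, s) - A (t, c) are those of a
   function of bounded r-variation; the uniformity in s comes from compactness. *)
Lemma bounded_variation2_cauchy a b c d (A : R * R -> V) e x0 eps :
    0 < r -> 0 < eps -> bounded_variation2 a b c d A ->
  \forall p & q \near side_nbhs a b e x0,
    forall s, `[c, d]%classic s -> `|rect_incr A p q c s| < eps.
Proof.
move=> r0 eps0 Abv.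
have row_cauchy s : c <= s <= d -> forall eta, 0 < eta ->
    \forall p & q \near side_nbhs a b e x0, `|rect_incr A p q c s| < eta.
  move=> csd eta eta0.
  have row_bv := bounded_variation2_row csd Abv.
  apply: filterS (bounded_variation1_cauchy e x0 r0 eta0 row_bv).
  by move=> [p q] /=; rewrite rect_incr_subE normrN.
(* Near-covering form of compactness: smallness is needed only jointly for [s] near each [y0] and
   [p], [q] near [x0]. The two sides of [y0] and [y0] itself are treated apart. *)
have /compact_near_coveringP/near_covering_withinP cover :=
  @segment_compact R c d.
apply: (cover _ (filter_prod (side_nbhs a b e x0) (side_nbhs a b e x0))
  (fun pq s => `|rect_incr A pq.1 pq.2 c s| < eps)) => y0; rewrite /= in_itv/= => cyd.
have [[U1 W1]/= [U1P W1P] sub1] :=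
  bounded_variation2_cauchy_quadrant true y0 r0 eps0 Abv row_cauchy.
have {}U1P : \forall s \near y0,
  `[c, d]%classic s /\ side true y0 s -> U1 s := U1P.
have [[U2 W2]/= [U2P W2P] sub2] :=
  bounded_variation2_cauchy_quadrant false y0 r0 eps0 Abv row_cauchy.
have {}U2P : \forall s \near y0,
  `[c, d]%classic s /\ side false y0 s -> U2 s := U2P.
have row0 := row_cauchy y0 cyd eps eps0.
near=> s pq => /= csd.
have [sy|ys|->] := ltgtP s y0.
- apply: (sub2 (s, pq)); split => /=; last by near: pq.
  by have := near U2P s; apply=> //; split => //; rewrite /side/= in_itv.
- apply: (sub1 (s, pq)); split => /=; last by near: pq.
  by have := near U1P s; apply=> //; split => //; rewrite /side/= in_itv/= ys.
- by near: pq.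
Unshelve. all: by end_near. Qed.

(** Cauchy criterion for one-sided limits in the sup norm over [[c, d]], phrased without a limit
    because [V] need not be complete. *)
Definition uniformly_regulated a b c d (A : R * R -> V) :=
  forall e x0 eps, 0 < eps ->
    \forall p & q \near side_nbhs a b e x0,
      forall s, `[c, d]%classic s -> `|A (p, s) - A (q, s)| < eps.

Lemma bounded_variation2_regulated a b c d (A : R * R -> V) : 0 < r ->
    bounded_variation2 a b c d A ->
    bounded_variation1 a b (fun t => A (t, c)) ->
  uniformly_regulated a b c d A.
Proof.
move=> r0 Abv2 Abv1 e x0 eps eps0.
have eps20 : 0 < eps / 2 by rewrite divr_gt0.
have cauchy2 := bounded_variation2_cauchy e x0 r0 eps20 Abv2.
have cauchy1 := bounded_variation1_cauchy e x0 r0 eps20 Abv1.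
apply: filterS2 cauchy1 cauchy2 => -[p q] /= pq1 pq2 s csd.
have -> : A (p, s) - A (q, s) = A (p, c) - A (q, c) - rect_incr A p q c s.
  rewrite rect_incr_subE opprK opprB !addrA.
  by rewrite [RHS](ACl (3*6*((1*4)*(2*5)))%AC)/= subrr addNr !addr0.
rewrite (splitr eps); apply: le_lt_trans (ler_normB _ _) _; by rewrite ltrD// pq2.
Qed.

Lemma bounded_variation2_swap a b c d (A : R * R -> V) :
  bounded_variation2 a b c d A ->
  bounded_variation2 c d a b (fun z => A (z.2, z.1)).
Proof.
move=> [C AC]; exists C => x y x_mono y_mono n m.
rewrite exchange_big/=; apply: le_trans (AC _ _ y_mono x_mono m n).
apply: ler_sum => j _; apply: ler_sum => k _.
by rewrite /rect_incr/= [X in `|X| `^ _](ACl (1*4*3*2)%AC).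
Qed.

(** The boundary term along [s = 2 ^- 3] feeds the estimate in [t], the one along [t = 1] the
    estimate in [s]. *)
Lemma variation2_regulated (A : R * R -> V) : 0 < r ->
    (variation2 V r A < +oo)%E ->
  uniformly_regulated 1 2 (2 ^- 3) (2 ^- 2) A /\
  uniformly_regulated (2 ^- 3) (2 ^- 2) 1 2 (fun z => A (z.2, z.1)).
Proof.
move=> r0 /variation2_fin[/(rect_variation_bounded r0) Abv2].
move=> /(variation1_bounded r0) sbv /(variation1_bounded r0) tbv.
split; first exact: bounded_variation2_regulated.
by apply: bounded_variation2_regulated => //; exact: bounded_variation2_swap.
Qed.

End BoundedVariation.

(** Serves to pass from a complex function to its real and imaginary parts. *)
Lemma uniformly_regulated_lipschitz (R : realType) (V W : normedZmodType R)
    (L : V -> W) a b c d (A : R * R -> V) :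
    (forall u v, `|L u - L v| <= `|u - v|) -> uniformly_regulated a b c d A ->
  uniformly_regulated a b c d (L \o A).
Proof.
move=> L_lip Areg e x0 eps eps0; apply: filterS (Areg e x0 eps eps0).
by move=> [p q] /= small s csd; apply: le_lt_trans (L_lip _ _) (small s csd).
Qed.

(** * Regulated maps: quadrant limits and countably many discontinuities *)

Section Regulated.
Context {R : realType}.

Lemma uniformly_regulated_side (V : normedZmodType R) a b c d (A : R * R -> V)
    e x0 eps :
    0 < eps -> uniformly_regulated a b c d A ->
  exists2 U, side_nbhs a b e x0 U &
    forall p q s, U p -> U q -> `[c, d]%classic s ->
      `|A (p, s) - A (q, s)| < eps.
Proof.
move=> eps0 /(_ e x0 eps eps0)[[U1 U2]/= [U1P U2P] sub].
exists (U1 `&` U2) => [|p q s [U1p _] [_ U2q] csd]; first exact: filterI.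
exact: (sub (p, q)).
Qed.

(** The bad points are sorted by the scale [1 / (n + 1)] at which closeness fails. Around any [x],
    the Cauchy property on each side makes every other nearby point close at that scale, so each
    [X n] consists of isolated points and is countable. *)
Lemma countable_irregular (V : normedZmodType R) a b c d (A : R * R -> V) :
    uniformly_regulated a b c d A ->
  countable [set t0 : R | `[a, b]%classic t0 /\ ~ forall eps : R, 0 < eps ->
    \forall t \near t0, `[a, b]%classic t ->
      forall s, `[c, d]%classic s -> `|A (t0, s) - A (t, s)| < eps].
Proof.
move=> Areg.
pose close eps t0 := \forall t \near t0, `[a, b]%classic t ->
  forall s, `[c, d]%classic s -> `|A (t0, s) - A (t, s)| < eps.
pose X n := [set t0 | `[a, b]%classic t0 /\ ~ close n.+1%:R^-1 t0].
apply: (@sub_countable _ _ _ (\bigcup_n X n)).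
  apply: subset_card_le => t0 [abt0] /existsNP[eps] /not_implyP[eps0 far].
  (* This index gives [1 / (n + 1) < eps]. *)
  exists (Num.truncn eps^-1) => //; split=> // close_n; apply: far.
  apply: filterS close_n => t close_n abt s csd.
  apply: lt_trans (close_n abt s csd) _.
  by rewrite invf_plt ?posrE// truncnS_gt.
apply: bigcup_countable => // n _.
apply: (sub_countable _ (countable_isolated (X n))).
apply: subset_card_le => x Xx; split; first exact/mem_set.
have close_side e : \forall p \near x, side e x p -> `[a, b]%classic p ->
    close n.+1%:R^-1 p.
  have n0 : 0 < n.+1%:R^-1 :> R by rewrite invr_gt0.
  have [U UP Usmall] := uniformly_regulated_side e x n0 Areg.
  have {}UP : \forall q \near x, `[a, b]%classic q /\ side e x q -> U q := UP.
  (* A neighbourhood of [x] is also one of every nearby [p], and the side is open, so [p] and the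
     points of [[a, b]] near it all fall in [U]. *)
  have UU := near_join UP.
  near=> p => xp abp.
  have side_p : \forall q \near p, side e x q.
    by apply: open_nbhs_nbhs; split => //; case: (e); exact: interval_open.
  have Up : U p by have := near UP p; apply.
  have Uq : \forall q \near p, `[a, b]%classic q /\ side e x q -> U q by near: p.
  apply: filterS2 side_p Uq => q xq Uq abq s csd.
  by apply: Usmall => //; exact: Uq.
exists [set p | (side true x p -> `[a, b]%classic p -> close n.+1%:R^-1 p) /\
                (side false x p -> `[a, b]%classic p -> close n.+1%:R^-1 p)].
  by apply: filterI; exact: close_side.
apply/seteqP; split => [p [[right left] [abp far]]|_ ->]; last first.
  by split => //=; split; rewrite /side/= in_itv/= ltxx.
have [px|px|//] := ltgtP p x; case: far.
- by apply: left => //; rewrite /side/= in_itv.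
- by apply: right => //; rewrite /side/= in_itv/= px.
Unshelve. all: by end_near. Qed.

(** By completeness of the reals a Cauchy condition suffices: the values at [z0] and [(t, s)] are
    compared through [(t, z0.2)], each leg costing [eps / 2]. *)
Lemma regulated_quadrant_limits (g : R * R -> R) :
    uniformly_regulated 1 2 (2 ^- 3) (2 ^- 2) g ->
    uniformly_regulated (2 ^- 3) (2 ^- 2) 1 2 (fun z => g (z.2, z.1)) ->
  has_quadrant_limits g.
Proof.
move=> treg sreg t0 s0 _ e e' _.
set F := within _ _.
have FF : Filter F by exact: within_filter.
(* An improper filter converges to any point; the Cauchy criterion is applied to a proper one. *)
have [F0|F0] := pselect (F set0).
  by exists 0 => U _; apply: filterS F0.
have PF : ProperFilter F by [].
suff : cvg (g @ F) by move=> /cvg_ex.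
apply/cauchy_cvgP; apply: cauchy_exP => eps eps0.
have eps20 : 0 < eps / 2 by rewrite divr_gt0.
have [U UP Usmall] := uniformly_regulated_side e t0 eps20 treg.
have [W WP Wsmall] := uniformly_regulated_side e' s0 eps20 sreg.
have FUW : F [set z | [/\ U z.1, W z.2, T0 z.1 & S0 z.2]].
  exists ([set t | T0 t /\ side e t0 t -> U t],
          [set s | S0 s /\ side e' s0 s -> W s]) => //.
  move=> [t s] /= [Ut Ws] [[tT sS] [et es]].
  by split; [apply: Ut|apply: Ws| |].
have [z0 [Uz0 Wz0 Tz0 Sz0]] := filter_ex FUW.
exists (g z0); apply: filterS FUW => -[t s] /= [Ut Ws Tt Ss].
rewrite /ball/= (splitr eps) -(subrKA (g (t, z0.2))) [z0]surjective_pairing/=.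
apply: le_lt_trans (ler_normD _ _) _; rewrite ltrD//.
  exact: Usmall.
exact: (Wsmall z0.2 s t).
Qed.

(** The exceptional sets are the sup-norm discontinuities of [t -> g (t, .)] and [s -> g (., s)];
    off them, [(t0, s0)] and [(t, s)] are compared through [(t0, s)]. *)
Lemma regulated_continuous (g : R * R -> R) :
    uniformly_regulated 1 2 (2 ^- 3) (2 ^- 2) g ->
    uniformly_regulated (2 ^- 3) (2 ^- 2) 1 2 (fun z => g (z.2, z.1)) ->
  continuous_off_countable g.
Proof.
move=> treg sreg; exists [set t0 : R | `[1, 2]%classic t0 /\ ~ forall eps : R, 0 < eps ->
    \forall t \near t0, `[1, 2]%classic t ->
      forall s, `[2 ^- 3, 2 ^- 2]%classic s -> `|g (t0, s) - g (t, s)| < eps].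
exists [set s0 : R | `[2 ^- 3, 2 ^- 2]%classic s0 /\ ~ forall eps : R, 0 < eps ->
    \forall s \near s0, `[2 ^- 3, 2 ^- 2]%classic s ->
      forall t, `[1, 2]%classic t -> `|g (t, s0) - g (t, s)| < eps].
split; [by move=> ? []|by move=> ? []|exact: countable_irregular treg
  |exact: countable_irregular sreg|].
move=> t0 s0 [/= Tt0 Ss0] tgood sgood.
apply/cvgrPdist_lt => eps eps0.
have eps20 : 0 < eps / 2 by rewrite divr_gt0.
have {}tgood : \forall t \near t0, `[1, 2]%classic t ->
      forall s, `[2 ^- 3, 2 ^- 2]%classic s -> `|g (t0, s) - g (t, s)| < eps / 2.
  by apply: contrapT => h; apply: tgood; split => // /(_ _ eps20).
have {}sgood : \forall s \near s0, `[2 ^- 3, 2 ^- 2]%classic s ->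
      forall t, `[1, 2]%classic t -> `|g (t, s0) - g (t, s)| < eps / 2.
  by apply: contrapT => h; apply: sgood; split => // /(_ _ eps20).
exists ([set t | `[1, 2]%classic t -> forall s, `[2 ^- 3, 2 ^- 2]%classic s ->
          `|g (t0, s) - g (t, s)| < eps / 2],
        [set s | `[2 ^- 3, 2 ^- 2]%classic s ->
          forall t, `[1, 2]%classic t -> `|g (t, s0) - g (t, s)| < eps / 2]) => //.
move=> [t s] /= [ht hs] [Tt Ss].
rewrite (splitr eps) -(subrKA (g (t0, s))).
apply: le_lt_trans (ler_normD _ _) _; rewrite ltrD//; first exact: hs.
exact: ht.
Qed.

(** * Complex values through real and imaginary parts *)

Lemma normc_le (z : R[i]) : `|z| <= (`|complex.Re z| + `|complex.Im z|)%:C%C.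
Proof.
rewrite normc_def lecR -(ler_pXn2r (n := 2)) ?nnegrE ?sqrtr_ge0 ?addr_ge0//.
rewrite sqr_sqrtr ?addr_ge0 ?sqr_ge0// sqrrD !real_normK ?num_real//.
by rewrite lerD2r lerDl mulrn_wge0// mulr_ge0.
Qed.

Lemma cvg_complex I (F : set_system I) {FF : Filter F} (f : I -> R[i]^o) (a b : R) :
    complex.Re (f z) @[z --> F] --> a -> complex.Im (f z) @[z --> F] --> b ->
  f @ F --> (a +i* b : R[i]^o)%C.
Proof.
move=> /cvgrPdist_lt fa /cvgrPdist_lt fb; apply/cvgrPdist_lt => eps eps0.
(* The tolerance lives in [R[i]], where positivity forces it to be real. *)
have [eta epsE] : exists eta : R, eps = eta%:C%C.
  by exists (complex.Re eps); rewrite RRe_real// gtr0_real.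
move: eps0; rewrite epsE ltcR => eta0.
have eta20 : 0 < eta / 2 by rewrite divr_gt0.
near=> z; apply: le_lt_trans (normc_le _) _.
rewrite ltcR (splitr eta) !raddfB/= ltrD//; near: z; [exact: fa|exact: fb].
Unshelve. all: by end_near. Qed.

End Regulated.

(* Real-valued and complex-valued functions.  Rcomplex R is R[i] with its
   R-valued modulus; R[i]^o is R[i] with its usual topology. *)
Theorem proposition2p6 (R : realType) (r : R) (hr : 1 <= r) :
  (forall A : R * R -> R,
    (variation2 R r A < +oo)%E ->
    has_quadrant_limits A /\ continuous_off_countable A) /\
  (forall A : R * R -> R[i]^o,
    (variation2 (Rcomplex R) r A < +oo)%E ->
    has_quadrant_limits A /\ continuous_off_countable A).
Proof.
have r0 : 0 < r by exact: lt_le_trans hr.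
split=> A /(variation2_regulated r0)[treg sreg].
  by split; [exact: regulated_quadrant_limits|exact: regulated_continuous].
have Re_lip (u v : Rcomplex R) : `|complex.Re u - complex.Re v| <= `|u - v|.
  rewrite -raddfB; case: (u - v) => x y.
  by rewrite -[leLHS]sqrtr_sqr ler_wsqrtr// lerDl sqr_ge0.
have Im_lip (u v : Rcomplex R) : `|complex.Im u - complex.Im v| <= `|u - v|.
  rewrite -raddfB; case: (u - v) => x y.
  by rewrite -[leLHS]sqrtr_sqr ler_wsqrtr// lerDr sqr_ge0.
have tRe := uniformly_regulated_lipschitz Re_lip treg.
have sRe := uniformly_regulated_lipschitz Re_lip sreg.
have tIm := uniformly_regulated_lipschitz Im_lip treg.
have sIm := uniformly_regulated_lipschitz Im_lip sreg.
split.
  move=> t0 s0 J e e' Q.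
  have [x xP] := regulated_quadrant_limits tRe sRe J Q.
  have [y yP] := regulated_quadrant_limits tIm sIm J Q.
  by exists (x +i* y)%C; exact: cvg_complex.
have [X [Y [XT YS Xc Yc cRe]]] := regulated_continuous tRe sRe.
have [X' [Y' [XT' YS' Xc' Yc' cIm]]] := regulated_continuous tIm sIm.
(* Both parts must be continuous, so the exceptional sets of both are avoided. *)
exists (X `|` X'), (Y `|` Y'); split.
- by rewrite subUset.
- by rewrite subUset.
- by rewrite -bigcup2E; apply: bigcup_countable => // -[|[|i]].
- by rewrite -bigcup2E; apply: bigcup_countable => // -[|[|i]].
move=> t0 s0 J /not_orP[Xt Xt'] /not_orP[Ys Ys'].
have -> : A (t0, s0) = (complex.Re (A (t0, s0)) +i* complex.Im (A (t0, s0)))%C.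
  by case: (A _).
by apply: cvg_complex; [exact: cRe|exact: cIm].
Qed.
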